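(* Let $K$ be a field and $K\langle X\rangle=K\langle X_1,\ldots,X_n\rangle$ the free $K$-algebra on $X=\{X_1,\ldots,X_n\}$, equipped with a fixed weight $\mathbb{N}$-gradation, and let $\prec_{gr}$ be an $\mathbb{N}$-graded monomial ordering on the set $\mathcal{B}$ of all monomials (words) of $K\langle X\rangle$ with respect to this gradation. Let $\mathcal{G}=\{g_1,\ldots,g_s\}$ be a finite (but not necessarily homogeneous) Gröbner basis, with respect to $\prec_{gr}$, for the proper ideal $I=\langle\mathcal{G}\rangle$ of $K\langle X\rangle$, such that $\mathbf{LM}(\mathcal{G})\cap X=\emptyset$ and $\mathbf{LM}(\mathcal{G})$ is reduced. Put $A=K\langle X\rangle/I$, and let $G(A)$ be the associated $\mathbb{N}$-graded algebra of $A$ with respect to the $\mathbb{N}$-filtration $FA$ induced by the $\mathbb{N}$-grading filtration of $K\langle X\rangle$. If the monomial algebra $\overline{A}=K\langle X\rangle/\langle\mathbf{LM}(\mathcal{G})\rangle$ is semi-prime, then $G(A)$ is semiprimitive.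
   Context: $\mathbb{N}$ is the set of nonnegative integers. Algebras are associative $K$-algebras with identity $1$, ideals are two-sided, and $\langle U\rangle$ denotes the two-sided ideal generated by a subset $U$. $\mathcal{B}$ denotes the standard $K$-basis of $K\langle X\rangle$ consisting of all monomials (words) in the $X_i$, including $1$. Weight $\mathbb{N}$-gradation: each $X_i$ is assigned a positive integer degree $m_i$, the degree $d(w)$ of a word $w$ is the sum of the degrees of its letters, and $K\langle X\rangle=\bigoplus_{p\in\mathbb{N}}K\langle X\rangle_p$, where $K\langle X\rangle_p$ is the $K$-span of all words of degree $p$. Monomial ordering: a well-ordering $\prec$ on $\mathcal{B}$ such that, for all $w,u,v,s\in\mathcal{B}$, $u\prec v$ implies $wus\prec wvs$, and $v=wus$ with $w\neq 1$ or $s\neq 1$ implies $u\prec v$. A total ordering $\prec$ on $\mathcal{B}$ induces the ordering $\prec_{gr}$ given by: $u\prec_{gr}v$ if and only if $d(u)<d(v)$, or $d(u)=d(v)$ and $u\prec v$. If $\prec_{gr}$ is a monomial ordering, it is called an $\mathbb{N}$-graded monomial ordering. Leading monomials: for nonzero $f=\sum_{i=1}^s\lambda_iw_i$ with $\lambda_i\in K\setminus\{0\}$ and $w_1\prec_{gr}\cdots\prec_{gr}w_s$ in $\mathcal{B}$, $\mathbf{LM}(f)=w_s$. For $S\subseteq K\langle X\rangle$, $\mathbf{LM}(S)$ is the set of leading monomials of the nonzero elements of $S$. Gröbner basis: a subset $\mathcal{G}\subseteq I\setminus\{0\}$ is a Gröbner basis of the ideal $I$ if $\langle\mathbf{LM}(I)\rangle=\langle\mathbf{LM}(\mathcal{G})\rangle$.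 Reduced: for $u,v\in\mathcal{B}$, $v$ divides $u$ if $u=wvs$ for some $w,s\in\mathcal{B}$. A subset $\Omega\subseteq\mathcal{B}$ is reduced if for all $u,v\in\Omega$ with $u\neq v$, $v$ does not divide $u$. Filtration and associated graded algebra: the $\mathbb{N}$-grading filtration of $K\langle X\rangle$ is $F_pK\langle X\rangle=\bigoplus_{q\le p}K\langle X\rangle_q$, $p\in\mathbb{N}$. For $A=K\langle X\rangle/I$, the induced filtration $FA=\{F_pA\}_{p\in\mathbb{N}}$ is $F_pA=(F_pK\langle X\rangle+I)/I$. The associated $\mathbb{N}$-graded algebra is $G(A)=\bigoplus_{p\in\mathbb{N}}G(A)_p$ with $G(A)_p=F_pA/F_{<p}A$, where $F_{<p}A=\bigcup_{q<p}F_qA$ and $F_{<0}A=\{0\}$, with the multiplication induced by that of $A$. An algebra $R$ is semi-prime if $a\in R$ and $aRa=\{0\}$ imply $a=0$. It is semiprimitive if its Jacobson radical is $J(R)=\{0\}$. *)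

(* Defs.v *)
From HB Require Import structures.
From mathcomp Require Import all_boot all_order all_algebra finmap.
From mathcomp Require Import boolp wochoice classical_sets.
From mathcomp Require Import monalg.

Set Implicit Arguments.
Unset Strict Implicit.
Unset Printing Implicit Defensive.

Import GRing.Theory.

Local Open Scope classical_set_scope.
Local Open Scope ring_scope.
Local Open Scope quotient_scope.

(* Rings are taken as pzRingType (1 = 0 allowed), so that R / <U> is a ring for
   every U; properness of ideals is a hypothesis where it is needed. *)

Section Ideals.
Variable R : pzRingType.
Implicit Types I M U : set R.

Definition left_ideal I :=
  [/\ I 0, forall a b, I a -> I b -> I (a - b) & forall r a, I a -> I (r * a)].

Definition ideal I := left_ideal I /\ forall r a, I a -> I (a * r).

Definition ideal_gen U : set R := smallest ideal U.

Definition maximal_left_ideal M :=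
  [/\ left_ideal M, M <> setT
    & forall I, left_ideal I -> M `<=` I -> I <> setT -> I = M].

Definition jacobson_radical : set R :=
  \bigcap_(M in [set M | maximal_left_ideal M]) M.

Definition semiprimitive := jacobson_radical = [set 0].

Definition semiprime := forall a : R, (forall r, a * r * a = 0) -> a = 0.

Lemma ideal_gen_ideal U : ideal (ideal_gen U).
Proof.
split; [split => [J [[[J0 _ _] _] _] // | a b Ia Ib J JU | r a Ia J JU] |
  move=> r a Ia J JU].
- by have [[_ JB _] _] := JU.1; apply: JB; [exact: Ia | exact: Ib].
- by have [[_ _ JM] _] := JU.1; apply: JM; exact: Ia.
- by have [_ JM] := JU.1; apply: JM; exact: Ia.
Qed.

End Ideals.

Section QuotientRing.
Variables (R : pzRingType) (U : set R).

Definition ideal_gen_pred : {pred R} := fun a => a \in ideal_gen U.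

Lemma ideal_gen_predP a : reflect (ideal_gen U a) (a \in ideal_gen_pred).
Proof. by apply: (iffP idP) => [|Ia]; [move/set_mem | apply/mem_set]. Qed.

Lemma ideal_gen_zmod_closed : zmod_closed ideal_gen_pred.
Proof.
have [[I0 IB _] _] := ideal_gen_ideal U.
by split=> [|a b /ideal_gen_predP Ia /ideal_gen_predP Ib];
  apply/ideal_gen_predP => //; apply: IB.
Qed.

HB.instance Definition _ :=
  GRing.isZmodClosed.Build R ideal_gen_pred ideal_gen_zmod_closed.

(* The quotient ring R / <U>. *)
Definition quot_ring : Type := Quotient.quot ideal_gen_pred.

HB.instance Definition _ := ZmodQuotient.on quot_ring.

Definition quot_proj (a : R) : quot_ring := \pi_quot_ring a.

Lemma quot_proj_surj x : exists a, x = quot_proj a.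
Proof. by exists (repr x); rewrite /quot_proj reprK. Qed.

Lemma eq_quot_proj a b : quot_proj a = quot_proj b <-> ideal_gen U (a - b).
Proof.
rewrite /quot_proj; split=> [/eqP|Iab].
  by rewrite -Quotient.idealrBE => /ideal_gen_predP.
by apply/eqP; rewrite -Quotient.idealrBE; apply/ideal_gen_predP.
Qed.

Lemma quot_proj_is_zmod_morphism : zmod_morphism quot_proj.
Proof. by move=> a b; rewrite /quot_proj pi_addr pi_oppr. Qed.

HB.instance Definition _ :=
  GRing.isZmodMorphism.Build R quot_ring quot_proj quot_proj_is_zmod_morphism.

Definition qone : quot_ring := quot_proj 1.
Definition qmul (x y : quot_ring) : quot_ring := quot_proj (repr x * repr y).

Lemma quot_projM a b : quot_proj (a * b) = qmul (quot_proj a) (quot_proj b).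
Proof.
have [[I0 IB IMl] IMr] := ideal_gen_ideal U.
rewrite /qmul /quot_proj.
case: piP => a' /eq_quot_proj Ia; case: piP => b' /eq_quot_proj Ib.
apply/eq_quot_proj.
have -> : a * b - a' * b' = (a - a') * b - a' * (b' - b).
  by rewrite mulrBl mulrBr opprB addrA addrNK.
apply: (IB); first exact: IMr.
by apply: IMl; rewrite -opprB -sub0r; apply: IB.
Qed.

Lemma qmulA : associative qmul.
Proof.
move=> x y z; have [a ->] := quot_proj_surj x; have [b ->] := quot_proj_surj y.
by have [c ->] := quot_proj_surj z; rewrite -!quot_projM mulrA.
Qed.

Lemma qmul1r : left_id qone qmul.
Proof.
by move=> x; have [a ->] := quot_proj_surj x; rewrite -quot_projM mul1r.
Qed.

Lemma qmulr1 : right_id qone qmul.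
Proof.
by move=> x; have [a ->] := quot_proj_surj x; rewrite -quot_projM mulr1.
Qed.

Lemma qmulDl : left_distributive qmul +%R.
Proof.
move=> x y z; have [a ->] := quot_proj_surj x; have [b ->] := quot_proj_surj y.
have [c ->] := quot_proj_surj z.
by rewrite -!quot_projM -!raddfD -quot_projM mulrDl.
Qed.

Lemma qmulDr : right_distributive qmul +%R.
Proof.
move=> x y z; have [a ->] := quot_proj_surj x; have [b ->] := quot_proj_surj y.
have [c ->] := quot_proj_surj z.
by rewrite -!quot_projM -!raddfD -quot_projM mulrDr.
Qed.

HB.instance Definition _ := GRing.Zmodule_isPzRing.Build quot_ring
  qmulA qmul1r qmulr1 qmulDl qmulDr.

Lemma quot_proj_is_monoid_morphism : monoid_morphism quot_proj.
Proof. by split=> // a b; rewrite quot_projM. Qed.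

HB.instance Definition _ :=
  GRing.isMonoidMorphism.Build R quot_ring quot_proj
    quot_proj_is_monoid_morphism.

Lemma quot_proj_eq0 a : quot_proj a = 0 <-> ideal_gen U a.
Proof. by rewrite -(raddf0 quot_proj) eq_quot_proj subr0. Qed.

End QuotientRing.

(* An exhaustive ascending N-filtration of a ring by additive subgroups. *)
Record filtration (A : pzRingType) := Filtration {
  fil :> nat -> set A;
  fil0 : forall p, fil p 0;
  filB : forall p a b, fil p a -> fil p b -> fil p (a - b);
  fil_le : forall p q, (p <= q)%N -> fil p `<=` fil q;
  fil1 : fil 0%N 1;
  filM : forall p q a b, fil p a -> fil q b -> fil (p + q)%N (a * b);
  fil_exhaustive : \bigcup_p fil p = setT
}.

Section AssociatedGraded.
Variables (A : pzRingType) (F : filtration A).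

Lemma filN p a : F p a -> F p (- a).
Proof. by move=> Fa; rewrite -sub0r; apply: filB => //; apply: fil0. Qed.

Lemma filD p a b : F p a -> F p b -> F p (a + b).
Proof. by move=> Fa Fb; rewrite -[b]opprK; apply: filB => //; apply: filN. Qed.

Lemma fil_sum p (I : Type) (r : seq I) (P : pred I) (a : I -> A) :
  (forall i, P i -> F p (a i)) -> F p (\sum_(i <- r | P i) a i).
Proof. by move=> Fa; elim/big_ind: _ => //; [exact: fil0 | exact: filD]. Qed.

Definition fil_lt (p : nat) : set A :=
  if p is 0 then [set 0] else \bigcup_(q in [set q | (q < p)%N]) F q.

Lemma fil_lt0 p : fil_lt p 0.
Proof. by case: p => [//|p]; exists 0%N => //; apply: fil0. Qed.

Lemma fil_ltB p a b : fil_lt p a -> fil_lt p b -> fil_lt p (a - b).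
Proof.
case: p => [-> ->|p]; first by rewrite /= subr0.
move=> [i /= ip Fa] [j /= jp Fb]; exists (maxn i j).
  by rewrite /= gtn_max ip.
by apply: filB;
  [apply: fil_le Fa; exact: leq_maxl | apply: fil_le Fb; exact: leq_maxr].
Qed.

Lemma fil_ltM_l p q a b : fil_lt p a -> F q b -> fil_lt (p + q)%N (a * b).
Proof.
case: p => [-> _|p [i /= ip Fa] Fb]; first by rewrite mul0r; exact: fil_lt0.
by exists (i + q)%N; [rewrite /= ltn_add2r | exact: filM].
Qed.

Lemma fil_ltM_r p q a b : F p a -> fil_lt q b -> fil_lt (p + q)%N (a * b).
Proof.
case: q => [_ ->|q Fa [i /= iq Fb]]; first by rewrite mulr0; exact: fil_lt0.
by rewrite addnS; exists (p + i)%N; [rewrite /= ltnS leq_add2l | exact: filM].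
Qed.

Definition fil_pred p : {pred A} := fun a => a \in F p.

Lemma fil_predP p a : reflect (F p a) (a \in fil_pred p).
Proof. by apply: (iffP idP) => [|Fa]; [move/set_mem | apply/mem_set]. Qed.

Lemma fil_zmod_closed p : zmod_closed (fil_pred p).
Proof.
split=> [|a b /fil_predP Fa /fil_predP Fb]; apply/fil_predP.
  exact: fil0.
exact: filB.
Qed.

HB.instance Definition _ p :=
  GRing.isZmodClosed.Build A (fil_pred p) (fil_zmod_closed p).

(* F_p as an additive group. *)
Record filt p := Filt { filt_val : A; filtP : filt_val \in fil_pred p }.

HB.instance Definition _ p := [isSub for @filt_val p].
HB.instance Definition _ p := [Choice of filt p by <:].
HB.instance Definition _ p := [SubChoice_isSubZmodule of filt p by <:].

Definition filt_lt p : {pred filt p} := fun x => val x \in fil_lt p.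

Lemma filt_ltP p (x : filt p) : reflect (fil_lt p (val x)) (x \in @filt_lt p).
Proof. by apply: (iffP idP) => [|Fa]; [move/set_mem | apply/mem_set]. Qed.

Lemma filt_lt_zmod_closed p : zmod_closed (@filt_lt p).
Proof.
split=> [|a b /filt_ltP Fa /filt_ltP Fb]; apply/filt_ltP.
  by rewrite raddf0; exact: fil_lt0.
by rewrite raddfB; exact: fil_ltB.
Qed.

HB.instance Definition _ p :=
  GRing.isZmodClosed.Build (filt p) (@filt_lt p) (@filt_lt_zmod_closed p).

(* The component G(A)_p = F_p / F_{<p}. *)
Definition gr p : Type := Quotient.quot (@filt_lt p).

HB.instance Definition _ p := ZmodQuotient.on (gr p).

Lemma eq_gr p (x y : filt p) :
  (\pi_(gr p) x = \pi_(gr p) y) <-> fil_lt p (val x - val y).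
Proof.
split=> [/eqP|Fxy].
  by rewrite -Quotient.idealrBE => /filt_ltP; rewrite raddfB.
by apply/eqP; rewrite -Quotient.idealrBE; apply/filt_ltP; rewrite raddfB.
Qed.

Lemma filt_mul_proof p q r (e : (p + q)%N = r) (x : filt p) (y : filt q) :
  val x * val y \in fil_pred r.
Proof.
by apply/fil_predP; rewrite -e; apply: filM; apply/fil_predP; exact: valP.
Qed.

Definition filt_mul p q r (e : (p + q)%N = r) (x : filt p) (y : filt q) :
    filt r :=
  Filt (filt_mul_proof e x y).

(* The product G(A)_p x G(A)_q -> G(A)_{p+q}; taking r with a proof of
   p + q = r instead of the index p + q avoids transports. *)
Definition gr_mul p q r (e : (p + q)%N = r) (x : gr p) (y : gr q) : gr r :=
  \pi_(gr r) (filt_mul e (repr x) (repr y)).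

Lemma pi_gr_mul p q r (e : (p + q)%N = r) (x : filt p) (y : filt q) :
  gr_mul e (\pi_(gr p) x) (\pi_(gr q) y) = \pi_(gr r) (filt_mul e x y).
Proof.
rewrite /gr_mul; case: piP => x' /eq_gr Fx; case: piP => y' /eq_gr Fy.
apply/eq_gr => /=; move: Fx Fy (filtP x') (filtP y); rewrite /=.
move: (filt_val x) (filt_val x') (filt_val y) (filt_val y') => a a' b b' Fx Fy.
move=> /fil_predP Fa' /fil_predP Fb.
have -> : a' * b' - a * b = 0 - (a' * (b - b') + (a - a') * b).
  by rewrite sub0r mulrBr mulrBl opprD !opprB addrA addrNK.
rewrite opprD addrA; apply: fil_ltB; last by rewrite -e; exact: fil_ltM_l.
by apply: fil_ltB; [exact: fil_lt0 | rewrite -e; exact: fil_ltM_r].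
Qed.

(* The direct sum of the G(A)_p: families with finitely many nonzero terms. *)
Record assoc_graded := AssocGraded {
  gcoef :> forall p, gr p;
  gcoef_fin : exists N, forall p, (N <= p)%N -> gcoef p = 0
}.

HB.instance Definition _ := gen_eqMixin assoc_graded.
HB.instance Definition _ := gen_choiceMixin assoc_graded.

Lemma assoc_gradedP (x y : assoc_graded) : (forall p, x p = y p) -> x = y.
Proof.
case: x y => [x xf] [y yf] /= exy.
have {}exy : x = y by exact: functional_extensionality_dep.
by case: _ / exy yf => yf; congr AssocGraded; exact: Prop_irrelevance.
Qed.

Lemma gzero_fin : exists N, forall p, (N <= p)%N -> (0 : gr p) = 0.
Proof. by exists 0%N. Qed.

Lemma gopp_fin (x : assoc_graded) :
  exists N, forall p, (N <= p)%N -> - x p = 0.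
Proof. by have [N xN] := gcoef_fin x; exists N => p /xN ->; rewrite oppr0. Qed.

Lemma gadd_fin (x y : assoc_graded) :
  exists N, forall p, (N <= p)%N -> x p + y p = 0.
Proof.
have [[M xM] [N yN]] := (gcoef_fin x, gcoef_fin y); exists (maxn M N) => p.
by rewrite geq_max => /andP[/xM -> /yN ->]; rewrite addr0.
Qed.

Definition gzero := AssocGraded gzero_fin.
Definition gopp x := AssocGraded (gopp_fin x).
Definition gadd x y := AssocGraded (gadd_fin x y).

Lemma gaddA : associative gadd.
Proof. by move=> x y z; apply: assoc_gradedP => p; rewrite /= addrA. Qed.
Lemma gaddC : commutative gadd.
Proof. by move=> x y; apply: assoc_gradedP => p; rewrite /= addrC. Qed.
Lemma gadd0 : left_id gzero gadd.
Proof. by move=> x; apply: assoc_gradedP => p; rewrite /= add0r. Qed.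
Lemma gaddN : left_inverse gzero gopp gadd.
Proof. by move=> x; apply: assoc_gradedP => p; rewrite /= addNr. Qed.

HB.instance Definition _ :=
  GRing.isZmodule.Build assoc_graded gaddA gaddC gadd0 gaddN.

Lemma gr0 p : 0 = \pi_(gr p) 0.
Proof. by rewrite pi_zeror. Qed.

Lemma gr_mul0l p q r (e : (p + q)%N = r) (y : gr q) : gr_mul e 0 y = 0.
Proof.
rewrite -[y]reprK (gr0 p) pi_gr_mul (gr0 r); apply/eq_gr.
by rewrite /= mul0r subr0; exact: fil_lt0.
Qed.

Lemma gr_mul0r p q r (e : (p + q)%N = r) (x : gr p) : gr_mul e x 0 = 0.
Proof.
rewrite -[x]reprK (gr0 q) pi_gr_mul (gr0 r); apply/eq_gr.
by rewrite /= mulr0 subr0; exact: fil_lt0.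
Qed.

Definition gmul_coef (x y : assoc_graded) (r : nat) : gr r :=
  \sum_(i < r.+1) gr_mul (subnKC (leq_ord i)) (x i) (y (r - i)%N).

Lemma gmul_fin (x y : assoc_graded) :
  exists N, forall p, (N <= p)%N -> gmul_coef x y p = 0.
Proof.
have [[M xM] [N yN]] := (gcoef_fin x, gcoef_fin y); exists (M + N)%N => p MNp.
rewrite /gmul_coef big1 // => i _; have [Mi|iM] := leqP M i.
  by rewrite xM // gr_mul0l.
have Npi : (N <= p - i)%N.
  rewrite leq_subRL ?leq_ord //; apply: leq_trans MNp.
  by rewrite leq_add2r ltnW.
by rewrite (yN _ Npi) gr_mul0r.
Qed.

Definition gmul x y := AssocGraded (gmul_fin x y).

Lemma fil1_pred : 1 \in fil_pred 0. Proof. exact/fil_predP/fil1. Qed.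

Definition gone_coef p : gr p :=
  if p is 0 then \pi_(gr 0) (Filt fil1_pred) else 0.

Lemma gone_fin : exists N, forall p, (N <= p)%N -> gone_coef p = 0.
Proof. by exists 1%N; case. Qed.

Definition gone := AssocGraded gone_fin.

(* The ring axioms are checked on representatives: gr_class p u is the class of
   u in G(A)_p, for u in F_p. *)
Definition gr_class p (u : A) : gr p := \pi_(gr p) (insubd 0 u).

Lemma val_insubd_fil p u : F p u -> val (insubd (0 : filt p) u) = u.
Proof. by move=> Fu; rewrite insubdK //; apply/fil_predP. Qed.

Lemma gr_classE p (x : filt p) : \pi_(gr p) x = gr_class p (val x).
Proof. by rewrite /gr_class valKd. Qed.

Lemma gr_class0 p : gr_class p 0 = 0.
Proof.
rewrite (gr0 p); apply/eq_gr; rewrite val_insubd_fil ?subr0 //=.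
  exact: fil_lt0.
exact: fil0.
Qed.

Lemma gr_classD p u v : F p u -> F p v ->
  gr_class p (u + v) = gr_class p u + gr_class p v.
Proof.
move=> Fu Fv; rewrite /gr_class -pi_addr; apply/eq_gr.
have -> : val (insubd 0 u + insubd 0 v : filt p) = u + v.
  by rewrite raddfD /= !val_insubd_fil.
rewrite val_insubd_fil ?subrr; last exact: filD.
exact: fil_lt0.
Qed.

Lemma gr_class_sum p n (u : 'I_n -> A) : (forall i, F p (u i)) ->
  gr_class p (\sum_i u i) = \sum_i gr_class p (u i).
Proof.
move=> Fu; suff [//] :
  F p (\sum_i u i) /\ gr_class p (\sum_i u i) = \sum_i gr_class p (u i).
elim/big_ind2: _ => [|a x b y [Fa <-] [Fb <-]|i _].
- by split; [exact: fil0 | exact: gr_class0].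
- by split; [exact: filD | exact: gr_classD].
- by [].
Qed.

Lemma gr_mul_class p q r (e : (p + q)%N = r) u v : F p u -> F q v ->
  gr_mul e (gr_class p u) (gr_class q v) = gr_class r (u * v).
Proof.
move=> Fu Fv; rewrite pi_gr_mul; apply/eq_gr; rewrite /= !val_insubd_fil //.
  by rewrite subrr; exact: fil_lt0.
by rewrite -e; exact: filM.
Qed.

Definition glifts (a : nat -> A) (x : assoc_graded) :=
  (forall p, F p (a p)) /\ (forall p, x p = gr_class p (a p)).

Lemma gliftsP x : exists a, glifts a x.
Proof.
exists (fun p => val (repr (x p))); split=> p.
  by apply/fil_predP; exact: valP.
by rewrite -gr_classE reprK.
Qed.

Lemma glifts_inj a x y : glifts a x -> glifts a y -> x = y.
Proof. by move=> [_ xa] [_ ya]; apply: assoc_gradedP => p; rewrite xa ya. Qed.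

Definition conv (a b : nat -> A) (r : nat) := \sum_(i < r.+1) a i * b (r - i)%N.

Lemma convA a b c r : conv a (conv b c) r = conv (conv a b) c r.
Proof.
pose coef3 j k := a j * (b (r - j - k)%N * c k).
have convC f g n : conv f g n = \sum_(i < n.+1) f (n - i)%N * g i.
  rewrite /conv (reindex_inj rev_ord_inj) /=; apply: eq_bigr => i _.
  by rewrite subSS subKn // leq_ord.
transitivity (\sum_(j < r.+1) \sum_(k < r.+1 | (k <= r - j)%N) coef3 j k).
  apply: eq_bigr => /= j _; rewrite convC big_distrr /=.
  by rewrite (big_ord_narrow_leq (leq_subr _ _)).
rewrite (exchange_big_dep predT) //= convC; apply: eq_bigr => k _.
transitivity (\sum_(j < r.+1 | (j <= r - k)%N) coef3 j k).
  apply: eq_bigl => j; rewrite -ltnS -(ltnS j) -!subSn ?leq_ord //.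
  by rewrite -subn_gt0 -(subn_gt0 j) -!subnDA addnC.
rewrite (big_ord_narrow_leq (leq_subr _ _)) big_distrl /=.
by apply: eq_bigr => j _; rewrite /coef3 -!subnDA addnC mulrA.
Qed.

Lemma glifts_mul a b x y : glifts a x -> glifts b y ->
  glifts (conv a b) (gmul x y).
Proof.
move=> [Fa xa] [Fb yb].
have Fab p (i : 'I_p.+1) : F p (a i * b (p - i)%N).
  by rewrite -[in F p](subnKC (leq_ord i)); apply: filM.
split=> p; first by apply: fil_sum => i _; exact: Fab.
rewrite /= /gmul_coef /conv gr_class_sum //; apply: eq_bigr => i _.
by rewrite xa yb gr_mul_class.
Qed.

Lemma glifts_add a b x y : glifts a x -> glifts b y -> glifts (a \+ b) (x + y).
Proof.
move=> [Fa xa] [Fb yb]; split=> p; first exact: filD.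
by rewrite /= xa yb gr_classD.
Qed.

Lemma glifts_one : glifts (fun p => if p is 0 then 1 else 0) gone.
Proof.
split=> -[|p]; [exact: fil1 | exact: fil0 | | by rewrite gr_class0].
by rewrite /= gr_classE.
Qed.

Lemma gmulA : associative gmul.
Proof.
move=> x y z; have [[a xa] [[b yb] [c zc]]] :=
  (gliftsP x, (gliftsP y, gliftsP z)).
apply: (@glifts_inj (conv a (conv b c))); first by do 2?apply: glifts_mul.
suff -> : conv a (conv b c) = conv (conv a b) c by do 2?apply: glifts_mul.
by apply/funext => r; exact: convA.
Qed.

Lemma gmul1 : left_id gone gmul.
Proof.
move=> x; have [a xa] := gliftsP x; apply: glifts_inj (xa).
suff {1}-> : a = conv (fun p => if p is 0 then 1 else 0) a.
  exact: glifts_mul glifts_one xa.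
apply/funext => r; rewrite /conv big_ord_recl /= mul1r subn0.
by rewrite big1 ?addr0 // => i _; rewrite mul0r.
Qed.

Lemma gmulr1 : right_id gone gmul.
Proof.
move=> x; have [a xa] := gliftsP x; apply: glifts_inj (xa).
suff {1}-> : a = conv a (fun p => if p is 0 then 1 else 0).
  exact: glifts_mul xa glifts_one.
apply/funext => r; rewrite /conv big_ord_recr /= subnn mulr1.
rewrite big1 ?add0r // => i _.
move: (ltn_ord i); rewrite -subn_gt0 /=; case: (r - i)%N => // k _.
by rewrite mulr0.
Qed.

Lemma gmulDl : left_distributive gmul +%R.
Proof.
move=> x y z; have [[a xa] [[b yb] [c zc]]] :=
  (gliftsP x, (gliftsP y, gliftsP z)).
apply: (@glifts_inj (conv (a \+ b) c)).
  by apply: glifts_mul => //; exact: glifts_add.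
suff -> : conv (a \+ b) c = conv a c \+ conv b c.
  by apply: glifts_add; exact: glifts_mul.
apply/funext => r; rewrite /conv /= -big_split; apply: eq_bigr => i _.
by rewrite mulrDl.
Qed.

Lemma gmulDr : right_distributive gmul +%R.
Proof.
move=> z x y; have [[a xa] [[b yb] [c zc]]] :=
  (gliftsP x, (gliftsP y, gliftsP z)).
apply: (@glifts_inj (conv c (a \+ b))).
  by apply: glifts_mul => //; exact: glifts_add.
suff -> : conv c (a \+ b) = conv c a \+ conv c b.
  by apply: glifts_add; exact: glifts_mul.
apply/funext => r; rewrite /conv /= -big_split; apply: eq_bigr => i _.
by rewrite mulrDr.
Qed.

HB.instance Definition _ := GRing.Zmodule_isPzRing.Build assoc_graded
  gmulA gmul1 gmulr1 gmulDl gmulDr.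

End AssociatedGraded.

(* The basis B of words in X_1, ..., X_n and the free algebra K<X>; the letter
   X_i is fmu i, the empty word is mone and concatenation is mmul. *)
Notation words n := {fmonom 'I_n}.
Notation free_algebra K n := {malg K[{fmonom 'I_n}]}.

Section FreeAlgebra.
Variables (K : fieldType) (n : nat).

Local Notation word := (words n).
Local Notation free_alg := (free_algebra K n).

Definition letters : set word := range (@fmu 'I_n).

Definition divides (v u : word) := exists w s : word, u = mmul (mmul w v) s.

Definition reduced (W : set word) :=
  forall u v, W u -> W v -> u <> v -> ~ divides v u.

Section Orders.
Variable lt : rel word.
Implicit Types (S I : set free_alg).

Definition total_ordering :=
  [/\ irreflexive lt, transitive lt & forall u v, [\/ u = v, lt u v | lt v u]].

Definition refl_closure : rel word := fun u v => (u == v) || lt u v.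

Definition monomial_ordering :=
  [/\ irreflexive lt, well_order refl_closure,
      forall w u v s, lt u v -> lt (mmul (mmul w u) s) (mmul (mmul w v) s)
    & forall w u v s,
        v = mmul (mmul w u) s -> w <> mone \/ s <> mone -> lt u v].

(* LM f is the last of the monomials of f listed in increasing order; it is the
   junk value mone for f = 0. *)
Definition LM (f : free_alg) : word := last mone (sort refl_closure (msupp f)).

Definition LM_set S : set word := [set LM f | f in S `\ 0].

Definition monomials (W : set word) : set free_alg :=
  [set (<< w >> : free_alg) | w in W].

Definition groebner_basis (G I : set free_alg) :=
  G `<=` I `\ 0 /\
  ideal_gen (monomials (LM_set I)) = ideal_gen (monomials (LM_set G)).

End Orders.

Section Weights.
Variable m : 'I_n -> nat.

Definition wdeg (w : word) : nat := (\sum_(i <- w) m i)%N.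

Definition graded_lt (lt : rel word) : rel word := fun u v =>
  (wdeg u < wdeg v)%N || (wdeg u == wdeg v) && lt u v.

(* The span of the words of degree p, i.e. the f supported on such words. *)
Definition homogeneous (p : nat) : set free_alg :=
  [set f | forall w, w \in msupp f -> wdeg w = p].

Definition grading_fil (p : nat) : set free_alg :=
  [set \sum_(q < p.+1) h q |
    h in [set h : 'I_p.+1 -> free_alg |
           forall q : 'I_p.+1, homogeneous q (h q)]].

Lemma grading_filP p f :
  grading_fil p f <-> forall w, w \in msupp f -> (wdeg w <= p)%N.
Proof.
split=> [[h hP <-] w|fP].
  apply: contraTT => wp; rewrite -mcoeff_eq0 raddf_sum /= big1 // => q _.
  apply/eqP; rewrite mcoeff_eq0; apply: contra wp => /hP ->.
  by rewrite -ltnS ltn_ord.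
exists (fun q : 'I_p.+1 => \sum_(w <- msupp f | wdeg w == q) << f@_w *g w >>).
  move=> q w; apply: contraTeq => wq; rewrite -mcoeff_eq0 raddf_sum /= big1 //.
  move=> v /eqP vq; rewrite mcoeffU; case: eqP => // vw.
  by rewrite -vw vq eqxx in wq.
rewrite (exchange_big_dep predT) //= [RHS]monalgE big_seq [RHS]big_seq.
apply: eq_bigr => w /fP wp; rewrite -ltnS in wp.
by rewrite (big_pred1 (Ordinal wp)) // => q; rewrite -val_eqE /= eq_sym.
Qed.

Section InducedFiltration.
Variable U : set free_alg.

(* F_p A = (F_p K<X> + I) / I, for A = K<X> / I and I = <U>. *)
Definition induced_fil (p : nat) : set (quot_ring U) :=
  @quot_proj _ U @` [set f + h | f in grading_fil p & h in ideal_gen U].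

Lemma induced_filE p : induced_fil p = @quot_proj _ U @` grading_fil p.
Proof.
apply/seteqP; split=> x [f]; last first.
  move=> Ff <-; exists f => //; exists f => //; exists 0; last by rewrite addr0.
  by case: (ideal_gen_ideal U) => -[].
move=> [g Fg [h Ih <-]] <-; exists g => //.
by rewrite raddfD /= (quot_proj_eq0 U h).2 // addr0.
Qed.

Lemma induced_fil0 p : induced_fil p 0.
Proof.
rewrite induced_filE; exists 0; last exact: raddf0.
by apply/grading_filP => w; rewrite msupp0 in_fset0.
Qed.

Lemma induced_filB p a b :
  induced_fil p a -> induced_fil p b -> induced_fil p (a - b).
Proof.
rewrite induced_filE => -[f /grading_filP Ff <-] [g /grading_filP Fg <-].
exists (f - g); last exact: raddfB.
apply/grading_filP => w /(fsubsetP (msuppB_le _ _)).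
by rewrite in_fsetU => /orP[/Ff|/Fg].
Qed.

Lemma induced_fil_le p q : (p <= q)%N -> induced_fil p `<=` induced_fil q.
Proof.
move=> pq x; rewrite !induced_filE => -[f /grading_filP Ff <-].
by exists f => //; apply/grading_filP => w /Ff wp; apply: leq_trans pq.
Qed.

Lemma wdeg1 : wdeg mone = 0%N.
Proof. by rewrite /wdeg fm1 big_nil. Qed.

Lemma wdegM u v : wdeg (mmul u v) = (wdeg u + wdeg v)%N.
Proof. by rewrite /wdeg fmM big_cat. Qed.

Lemma induced_fil1 : induced_fil 0 1.
Proof.
rewrite induced_filE; exists 1; last exact: rmorph1.
apply/grading_filP => w; rewrite msuppU1 in_fset1 => /eqP ->.
by rewrite wdeg1.
Qed.

Lemma induced_filM p q a b :
  induced_fil p a -> induced_fil q b -> induced_fil (p + q)%N (a * b).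
Proof.
rewrite !induced_filE => -[f /grading_filP Ff <-] [g /grading_filP Fg <-].
exists (f * g); last exact: rmorphM.
apply/grading_filP => w /msuppM_le[u [v [/Ff up /Fg vq ->]]].
by rewrite wdegM leq_add.
Qed.

Lemma induced_fil_exhaustive : \bigcup_p induced_fil p = setT.
Proof.
apply/seteqP; split=> // x _; have [f ->] := quot_proj_surj x.
exists (\max_(w <- msupp f) wdeg w)%N => //; rewrite induced_filE.
by exists f => //; apply/grading_filP => w wf; apply: leq_bigmax_seq.
Qed.

Definition induced_filtration : filtration (quot_ring U) :=
  Filtration induced_fil0 induced_filB induced_fil_le induced_fil1 induced_filM
    induced_fil_exhaustive.

End InducedFiltration.
End Weights.
End FreeAlgebra.

Arguments letters {n}.
Arguments monomials K {n} W.

(* Main.v *)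
Require Import Defs.
From mathcomp Require Import all_boot all_order all_algebra finmap.
From mathcomp Require Import boolp wochoice classical_sets.
From mathcomp Require Import monalg zify.

Set Implicit Arguments.
Unset Strict Implicit.
Unset Printing Implicit Defensive.

Import GRing.Theory.

Local Open Scope classical_set_scope.
Local Open Scope ring_scope.

(** Call a word normal if no word of [LM(G)] divides it.  The Groebner basis
    property makes the normal words a basis of [A = K<X> / I], and because the
    ordering compares weights first they also describe [G(A)]: every nonzero
    homogeneous element of [G(A)] has a normal leading word [ex_normal_lead], an
    element whose leading word is normal is nonzero [symbol_normal_neq0], and
    leading words multiply by concatenation [leads_mul], whether or not the
    product is normal.  So a product in [G(A)] is nonzero as soon as the product
    of the leading words is normal.

    Semiprimeness of the monomial algebra says that each normal word [w] has a
    normal word of the form [w u w].  As [LM(G)] is finite, normality is tested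
    on factors of bounded length, so two normal words that overlap in a long
    word can be glued [normal_glue].  Together these give, for a normal word
    [w <> 1], a word [u] all of whose powers [(u w)^k] are normal
    [normal_powers].  Hence every element of [G(A)] led by [w] has a left
    multiple whose top component is not nilpotent.

    Now suppose that the Jacobson radical [J] of [G(A)] is nonzero, and choose a
    nonzero [x] in [J] with the smallest possible spread between its lowest and
    highest degrees.  If [h] is the top component of [x], then [h x - x h] lies
    in [J] and has a smaller spread, so [h] commutes with [x]; the same is true
    for [u x] for each homogeneous [u] [ex_top_commuting].  With the [u] above,
    the top component of [u x] commutes with [u x] and is not nilpotent, which
    prevents [1 - u x] from having a left inverse, by comparing top degrees
    [no_left_inverse]; but elements of [J] are quasi-regular
    [jacobson_radicalE].  When the leading word of [x] is empty, [x] is a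
    nonzero constant, which is invertible and so not in [J] either.  Taking an
    element of smallest spread replaces the theorem that the Jacobson radical of
    a graded ring is homogeneous. *)

(** * Quasi-regularity and the Jacobson radical *)

Section JacobsonRadical.
Variable R : pzRingType.
Implicit Types (x y r : R) (I M : set R).

Definition left_quasi_regular x := forall r, exists y, y * (1 - r * x) = 1.

Lemma left_idealM I r x : left_ideal I -> I x -> I (r * x).
Proof. by case=> _ _ IM Ix; apply: IM. Qed.

Lemma left_idealD I x y : left_ideal I -> I x -> I y -> I (x + y).
Proof.
move=> [I0 IB _] Ix Iy; rewrite -[y]opprK -[- y]sub0r.
by apply: (IB) => //; apply: (IB).
Qed.

Lemma left_ideal1 I : left_ideal I -> I 1 -> I = setT.
Proof.
by move=> LI I1; apply/seteqP; split=> // x _; rewrite -[x]mulr1; apply: left_idealM.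
Qed.

(** Zorn's lemma: omitting [1] passes from a chain of left ideals to its union,
    and a left ideal is proper exactly when it omits [1]. *)
Lemma ex_maximal_left_ideal I : left_ideal I -> ~ I 1 ->
  exists2 M, maximal_left_ideal M & I `<=` M.
Proof.
move=> LI I1; pose P J := (left_ideal J /\ ~ J 1) /\ I `<=` J.
(* The empty chain has the union [set0], so [set0] has to be let in. *)
have [] := @Zorn_bigcup R [set J | J = set0 \/ P J].
  move=> F FP Ftot.
  have [[J0 FJ0 [[LJ0 _] IJ0]]|noP] := pselect (exists2 J, F J & P J); last first.
    left; apply/seteqP; split=> // x [J FJ Jx]; have [J0|PJ] := FP _ FJ.
      by rewrite J0 in Jx.
    by case: noP; exists J.
  right; split; last by move=> x Ix; exists J0 => //; apply: IJ0.
  have FI J x : F J -> J x -> left_ideal J /\ ~ J 1.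
    by move=> /FP[->//|[? _] _].
  split; last by move=> [J FJ J1]; have [_ /(_ J1)] := FI _ _ FJ J1.
  split=> [|a b [J FJ Ja] [J' FJ' Jb]|r a [J FJ Ja]].
  - by exists J0 => //; case: LJ0.
  - have [JJ'|J'J] := Ftot _ _ FJ FJ'.
      have [[_ JB _] _] := FI _ _ FJ' Jb.
      by exists J' => //; apply: JB => //; apply: JJ'.
    have [[_ JB _] _] := FI _ _ FJ Ja.
    by exists J => //; apply: JB => //; apply: J'J.
  - by have [LJ _] := FI _ _ FJ Ja; exists J => //; apply: left_idealM.
move=> M [[M0|[[LM M1] IM]] Mmax].
  case: (Mmax I); last by right; split.
  by rewrite M0; split=> [|I0]; [exact: sub0set | apply: (I0 0); case: LI].
exists M => //; split=> // [MT|J LJ MJ JT]; first by apply: M1; rewrite MT.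
apply: contrapT => JM; apply: (Mmax J); last first.
  right; split; last exact: subset_trans MJ.
  by split=> // /(left_ideal1 LJ).
by rewrite properEneq; split=> //; apply/eqP => MJe; apply: JM.
Qed.

(** If [R (1 - r x)] were proper it would sit in a maximal left ideal [M], which
    contains [r x] and therefore [1].  Conversely, if [x] is outside [M] then
    [1 = a + r x] with [a] in [M], and [a = 1 - r x] is left invertible. *)
Lemma jacobson_radicalE : @jacobson_radical R = [set x | left_quasi_regular x].
Proof.
apply/seteqP; split=> [x Jx r | x qx M [LM MT Mmax]].
  pose I := range (fun y => y * (1 - r * x)).
  have LI : left_ideal I.
    split=> [|_ _ [a _ <-] [b _ <-]|s _ [a _ <-]].
    - by exists 0 => //; rewrite mul0r.
    - by exists (a - b) => //; rewrite mulrBl.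
    - by exists (s * a) => //; rewrite mulrA.
  have [[y _ e]|I1] := pselect (I 1); first by exists y.
  have [M maxM IM] := ex_maximal_left_ideal LI I1.
  have [LM MT _] := maxM; case: MT; apply: left_ideal1 => //.
  rewrite -(subrK (r * x) 1); apply: left_idealD => //.
    by apply: IM; exists 1 => //; rewrite mul1r.
  by apply: left_idealM => //; apply: Jx.
apply: contrapT => Mx.
pose I := [set z | exists2 a, M a & exists r, z = a + r * x].
have LI : left_ideal I.
  have [M0 MB MM] := LM.
  split=> [|_ _ [a Ma [r ->]] [b Mb [s ->]]|s _ [a Ma [r ->]]].
  - by exists 0 => //; exists 0; rewrite mul0r addr0.
  - exists (a - b); first exact: MB.
    by exists (r - s); rewrite mulrBl opprD addrACA.
  - exists (s * a); first exact: MM.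
    by exists (s * r); rewrite mulrDr mulrA.
have MI : M `<=` I by move=> a Ma; exists a => //; exists 0; rewrite mul0r addr0.
have Ix : I x by case: LM => M0 _ _; exists 0 => //; exists 1; rewrite add0r mul1r.
have IT : I = setT.
  by apply: contrapT => /(Mmax _ LI MI) IM; apply: Mx; rewrite -IM.
have [a Ma [r e]] : I 1 by rewrite IT.
have [y ye] := qx r; apply: MT; apply: left_ideal1 => //.
by rewrite -ye e addrK; apply: left_idealM.
Qed.

Lemma jacobson_radical_left_ideal : left_ideal (@jacobson_radical R).
Proof.
split=> [M [[]] //|a b Ja Jb M maxM|r a Ja M maxM]; have [LM _ _] := maxM.
  by case: LM => _ + _; apply; [apply: Ja | apply: Jb].
by apply: left_idealM => //; apply: Ja.
Qed.

(** A left inverse [y] of [1 - s r x] yields the left inverse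
    [1 + r x y s] of [1 - r x s]; this makes the radical two-sided. *)
Lemma jacobson_radicalMr x s :
  @jacobson_radical R x -> @jacobson_radical R (x * s).
Proof.
rewrite jacobson_radicalE => qx r; have [y ye] := qx (s * r).
have e : s * (1 - r * (x * s)) = (1 - s * r * x) * s.
  by rewrite mulrBr mulr1 mulrBl mul1r !mulrA.
exists (1 + r * x * y * s); rewrite mulrDl mul1r -(mulrA _ s) e.
by rewrite [r * x * y * _]mulrA -(mulrA _ y) ye mulr1 [r * (x * s)]mulrA subrK.
Qed.

End JacobsonRadical.

(** * Top components in the associated graded ring *)

Section GradedRing.
Variables (A : pzRingType) (F : filtration A).
Local Notation R := (assoc_graded F).
Implicit Types (x y h : R) (p q t d : nat).

Definition gdeg_le t x := forall q, (t < q)%N -> x q = 0.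
Definition gdeg_ge t x := forall q, (q < t)%N -> x q = 0.

Lemma ex_gdeg x : x <> 0 -> exists2 t, gdeg_le t x & x t <> 0.
Proof.
move=> x0; have [N xN] := gcoef_fin x.
have Ntop : gdeg_le N x by move=> q /ltnW /xN.
have exN : exists N, `[< gdeg_le N x >] by exists N; apply/asboolP.
case: (ex_minnP exN) => t /asboolP tx tmin; exists t => // xt; apply: x0.
case: t tx tmin xt => [|t] tx tmin xt.
  by apply: assoc_gradedP => -[|q] //; apply: tx.
have /asboolP/tmin : gdeg_le t x; last by rewrite ltnn.
by move=> q; rewrite leq_eqVlt => /predU1P[<-|/tx].
Qed.

Lemma gcoefM (x y : R) r : (x * y) r = gmul_coef x y r.
Proof. by []. Qed.

Lemma gdeg_leM t t' x y : gdeg_le t x -> gdeg_le t' y -> gdeg_le (t + t') (x * y).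
Proof.
move=> tx ty r tr; rewrite gcoefM /gmul_coef big1 // => i _.
have [ti|it] := ltnP t i; first by rewrite tx // gr_mul0l.
rewrite ty ?gr_mul0r // ltn_subRL; apply: leq_ltn_trans tr.
by rewrite leq_add2r.
Qed.

Lemma gdeg_geM t t' x y : gdeg_ge t x -> gdeg_ge t' y -> gdeg_ge (t + t') (x * y).
Proof.
move=> tx ty r tr; rewrite gcoefM /gmul_coef big1 // => i _.
have [ti|it] := ltnP i t; first by rewrite tx // gr_mul0l.
rewrite ty ?gr_mul0r // ltn_subLR ?leq_ord //.
by apply: leq_trans tr _; rewrite leq_add2r.
Qed.

(** Only one pair of degrees contributes to the top degree of a product. *)
Lemma gcoefM_top t t' x y : gdeg_le t x -> gdeg_le t' y ->
  (x * y) (t + t')%N = gr_mul erefl (x t) (y t').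
Proof.
move=> tx ty; rewrite gcoefM /gmul_coef.
have tlt : (t < (t + t').+1)%N by rewrite ltnS leq_addr.
rewrite (bigD1 (Ordinal tlt)) //= big1 ?addr0 => [|i].
  move: (subnKC _) => /= e.
  suff gen q (e' : (t + q)%N = (t + t')%N) (qt : q = t') :
    gr_mul e' (x t) (y q) = gr_mul erefl (x t) (y t') by apply: gen; rewrite addKn.
  by subst q; rewrite (eq_irrelevance e' erefl).
rewrite -val_eqE /= => it.
have [ti|it'] := ltnP t i; first by rewrite tx // gr_mul0l.
by rewrite ty ?gr_mul0r // ltn_subRL ltn_add2r ltn_neqAle it.
Qed.

Lemma gdeg_leB t x y : gdeg_le t x -> gdeg_le t y -> gdeg_le t (x - y).
Proof. by move=> tx ty q tq; rewrite [LHS]/= tx // ty // subr0. Qed.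

Lemma gdeg_geB t x y : gdeg_ge t x -> gdeg_ge t y -> gdeg_ge t (x - y).
Proof. by move=> tx ty q tq; rewrite [LHS]/= tx // ty // subr0. Qed.

Lemma gcoefB x y q : (x - y) q = x q - y q.
Proof. by []. Qed.

(** The component of [x] in degree [d], as an element of the ring rather than of
    [gr F d]; the family is indexed so that no transport of [x d] is needed. *)
Definition gcomp_coef d x q : gr F q := if q == d then x q else 0.

Lemma gcomp_fin d x :
  exists N, forall q, (N <= q)%N -> gcomp_coef d x q = 0.
Proof.
by exists d.+1 => q dq; rewrite /gcomp_coef gtn_eqF.
Qed.

Definition gcomp d x : R := AssocGraded (gcomp_fin d x).

Lemma gcompE d x : gcomp d x d = x d.
Proof. by rewrite /= /gcomp_coef eqxx. Qed.

Lemma gcomp_le d x : gdeg_le d (gcomp d x).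
Proof. by move=> q dq; rewrite /= /gcomp_coef gtn_eqF. Qed.

Lemma gcomp_ge d x : gdeg_ge d (gcomp d x).
Proof. by move=> q dq; rewrite /= /gcomp_coef ltn_eqF. Qed.

Lemma gdeg_le1 : gdeg_le 0 (1 : R).
Proof. by case. Qed.

Lemma gdeg_leX d k x : gdeg_le d x -> gdeg_le (k * d) (x ^+ k).
Proof.
move=> dx; elim: k => [|k IH]; first exact: gdeg_le1.
by rewrite exprS mulSn; apply: gdeg_leM.
Qed.

Lemma gdeg_geX d k x : gdeg_ge d x -> gdeg_ge (k * d) (x ^+ k).
Proof.
move=> dx; elim: k => [|k IH] //.
by rewrite exprS mulSn; apply: gdeg_geM.
Qed.

(** In degree [2 (b + s)] the commutator of [x] with its top component [h] is
    [h h - h h = 0], so its spread of degrees is smaller than that of [x]. *)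
Lemma gcomp_commutator b s x : gdeg_le (b + s) x -> gdeg_ge b x ->
  let h := gcomp (b + s) x in
  let c := h * x - x * h in
  gdeg_ge (b + s + b) c /\ forall q, (b + s + b + s <= q)%N -> c q = 0.
Proof.
move=> tx bx h c; have th : gdeg_le (b + s) h := @gcomp_le _ _.
have bh : gdeg_ge (b + s) h := @gcomp_ge _ _.
split; first by apply: gdeg_geB; [|rewrite addnC]; apply: gdeg_geM.
move=> q; rewrite -[X in (X <= _)%N]addnA leq_eqVlt => /predU1P[<-|lq].
  by rewrite gcoefB !gcoefM_top // gcompE subrr.
by apply: (@gdeg_leB (b + s + (b + s))) => //; apply: gdeg_leM.
Qed.

(** Let [h] be the top component.  From [y (1 - x) = 1] and the commutation of [h]
    and [x] one gets [y h^k (1 - x) = h^k].  The excess of the degree of [y h^k]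
    over [k d] does not increase with [k], so it is constant from some [k] on;
    then the top component of [y h^k] is not killed by [h], and the product
    with [1 - x] has a nonzero component in a degree above [k d]. *)
Lemma no_left_inverse d x y :
  (0 < d)%N -> gdeg_le d x -> GRing.comm (gcomp d x) x ->
  (forall k, gcomp d x ^+ k <> 0) -> y * (1 - x) = 1 -> False.
Proof.
set h := gcomp d x => d0 tx hx hX yx.
have hXx k : h ^+ k * (1 - x) = (1 - x) * h ^+ k.
  by rewrite mulrBr mulrBl mulr1 mul1r [x * _]commrX.
have yhX k : y * h ^+ k * (1 - x) = h ^+ k.
  by rewrite -mulrA hXx mulrA yx mul1r.
have yhX0 k : y * h ^+ k <> 0.
  by move=> e; apply: (hX k); rewrite -yhX e mul0r.
(* [j] below is the smallest excess of the degree of [y h^k] over [k d]. *)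
have exj : exists j, `[< exists k, gdeg_le (j + k * d) (y * h ^+ k) >].
  have [t ty _] := ex_gdeg (yhX0 0%N).
  by exists t; apply/asboolP; exists 0%N; rewrite addn0.
case: (ex_minnP exj) => j /asboolP[k tk] jmin.
have th : gdeg_le d h := @gcomp_le _ _.
have tk1 : gdeg_le (j + k.+1 * d) (y * h ^+ k.+1).
  by rewrite mulSn addnCA addnC exprSr mulrA; apply: gdeg_leM.
have top1 : (y * h ^+ k.+1) (j + k.+1 * d)%N = 0.
  have -> : (j + k.+1 * d = j + k * d + d)%N by rewrite mulSn addnCA addnC.
  rewrite exprSr mulrA gcoefM_top // gcompE -gcoefM_top //.
  have := congr1 (fun z : R => z (j + k * d + d)%N) (yhX k).
  rewrite mulrBr mulr1 gcoefB tk; last by rewrite -[X in (X < _)%N]addn0 ltn_add2l.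
  rewrite (@gdeg_leX d k h th) ?sub0r; last first.
    by rewrite -addnA addnCA -[X in (X < _)%N]addn0 ltn_add2l addn_gt0 d0 orbT.
  by move/eqP; rewrite oppr_eq0 => /eqP.
(* Excess [0] and no component in degree [k.+1 * d] means [y h^k.+1 = 0]; a
   positive excess could be lowered by one. *)
case: j jmin tk1 top1 {tk exj} => [|j] jmin tk1 top1.
  apply: (yhX0 k.+1).
  have bk : gdeg_ge (k.+1 * d) (y * h ^+ k.+1).
    by rewrite -[X in gdeg_ge X]add0n; apply: gdeg_geM => //; apply/gdeg_geX/gcomp_ge.
  apply: assoc_gradedP => q; case: (ltngtP q (k.+1 * d)) => [/bk//|/tk1//|->] //.
have /asboolP/jmin : exists k, gdeg_le (j + k * d) (y * h ^+ k).
  exists k.+1 => q; rewrite leq_eqVlt => /predU1P[<-//|]; exact: tk1.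
by rewrite ltnn.
Qed.

(** For [x] of least spread among the nonzero elements of [J], the commutator of
    [gcomp_commutator] must vanish.  Multiplying [x] by a homogeneous [u] moves
    its degrees without enlarging the spread, so the argument applies to [u x],
    even when [u] kills the top component of [x]. *)
Lemma ex_top_commuting (J : set R) x0 : left_ideal J ->
  (forall x y, J x -> J (x * y)) -> J x0 -> x0 <> 0 ->
  exists t x, [/\ J x, gdeg_le t x, x t <> 0 &
    forall u e, gdeg_le e u -> gdeg_ge e u ->
    GRing.comm (gcomp (e + t) (u * x)) (u * x)].
Proof.
move=> LJ JMr Jx0 x00.
pose spread s := exists b x, [/\ J x, x <> 0, gdeg_le (b + s) x & gdeg_ge b x].
have exs : exists s, `[< spread s >].
  have [t tx _] := ex_gdeg x00.
  by exists t; apply/asboolP; exists 0%N, x0.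
case: (ex_minnP exs) => s /asboolP[b [x [Jx x_neq0 tx bx]]] smin.
have shrink z c : J z -> gdeg_ge c z ->
    (forall q, (c + s <= q)%N -> z q = 0) -> z = 0.
  move=> Jz bz tz; apply: contrapT => z0.
  case: s smin tx tz => [|s] smin tx tz.
    apply: z0; apply: assoc_gradedP => q; have [/bz//|cq] := ltnP q c.
    by apply: tz; rewrite addn0.
  have /asboolP/smin : spread s; last by rewrite ltnn.
  by exists c, z; split=> // q cq; apply: tz; rewrite addnS.
exists (b + s)%N, x; split=> // [x_top|u e tu bu].
  apply: x_neq0; apply: (shrink x b) => // q.
  by rewrite leq_eqVlt => /predU1P[<-|/tx].
apply/eqP; rewrite -subr_eq0; apply/eqP; rewrite addnA.
have [||cb ct] := @gcomp_commutator (e + b) s (u * x).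
- by rewrite -addnA; apply: gdeg_leM.
- exact: gdeg_geM.
have Jux := left_idealM u LJ Jx.
apply: (shrink _ _ _ cb ct); case: (LJ) => _ JB _.
by apply: JB; [apply: left_idealM | apply: JMr].
Qed.

End GradedRing.

(** * Normal words *)

(** A factor of [x w y] that is neither in [x w] nor in [w y] begins inside [x]
    and ends inside [y], so it contains [w] and at least two more letters. *)
Lemma infix_glue (T : eqType) (v x w y : seq T) :
  (size v <= (size w).+1)%N -> infix v (x ++ w ++ y) ->
  infix v (x ++ w) \/ infix v (w ++ y).
Proof.
move=> vw /infixP[a [b e]].
have := congr1 size e; rewrite !size_cat => es.
have [xa|ax] := leqP (size x) (size a).
  right; apply/infixP; exists (drop (size x) a), b; apply/eqP; move/eqP: e.
  rewrite -{1}(cat_take_drop (size x) a) -catA.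
  by rewrite eqseq_cat ?size_takel // => /andP[].
have [yb|by_] := leqP (size y) (size b).
  left; apply/infixP; exists a, (take (size b - size y) b); apply/eqP.
  move/eqP: e; rewrite -{1}(cat_take_drop (size b - size y) b) !catA.
  rewrite eqseq_cat => [/andP[]//|]; rewrite !size_cat size_takel ?leq_subr //.
  by rewrite addnBA // -!addnA -es !addnA addnK.
by lia.
Qed.

Section Words.
Variable n : nat.
Local Notation word := (words n).
Implicit Types (u v w x y : word) (W : set word).

Lemma dividesE v u : divides v u <-> infix v u.
Proof.
split=> [[a [b ->]]|/infixP[a [b e]]].
  by apply/infixP; exists a, b; rewrite !fmM catA.
by exists (FMonom a), (FMonom b); apply/val_inj; rewrite /= !fmM /= e catA.
Qed.

Definition normal W w := forall v, W v -> ~ divides v w.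

Lemma normal_factor W a w b : normal W (mmul (mmul a w) b) -> normal W w.
Proof.
move=> Nw v Wv [a' [b' e]]; apply: (Nw v Wv).
by exists (mmul a a'), (mmul b' b); rewrite e !mulmA.
Qed.

Lemma normal_suffix W a w : normal W (mmul a w) -> normal W w.
Proof. by rewrite -[mmul a w]mulm1; apply: normal_factor. Qed.

Lemma normal_glue W x w y :
  (forall v, W v -> (size v <= (size w).+1)%N) ->
  normal W (mmul x w) -> normal W (mmul w y) -> normal W (mmul (mmul x w) y).
Proof.
move=> Wle Nxw Nwy v Wv /dividesE; rewrite !fmM -catA.
move=> /(infix_glue (Wle v Wv)); rewrite -!fmM => -[] /dividesE.
  exact: Nxw.
exact: Nwy.
Qed.

Definition wpow w k : word := iter k (mmul w) mone.

Lemma size_word_gt0 w : w <> mone -> (0 < size w)%N.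
Proof. by rewrite lt0n => w1; apply/eqP => /fdeg_eq0I. Qed.

Section Sandwich.
Variable W : set word.
Hypothesis sandwich : forall w, normal W w ->
  exists u, normal W (mmul (mmul w u) w).

(** Passing from [w'] to [w' z w'] at least doubles the length. *)
Lemma normal_extend k w : normal W w -> w <> mone ->
  exists2 u, normal W (mmul u w) & (k <= size (mmul u w))%N.
Proof.
move=> Nw w1; elim: k => [|k [u Nu ku]]; first by exists mone; rewrite ?mul1m.
have [z Nz] := sandwich Nu; exists (mmul (mmul (mmul u w) z) u).
  by rewrite mulmA in Nz.
have := size_word_gt0 w1; move: ku; rewrite !fmM !size_cat.
by lia.
Qed.

(** Take a normal word [w' = u' w] with [N <= size w'] and a normal
    [w' u w'].  Gluing copies of the latter along [w'] shows that
    [w' (u w')^k] is normal, and [u w' = (u u') w]. *)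
Lemma normal_powers N w : (forall v, W v -> (size v <= N)%N) ->
  normal W w -> w <> mone -> exists u, forall k, normal W (wpow (mmul u w) k).
Proof.
move=> WN Nw w1; have [u' Nu' sz] := normal_extend N Nw w1.
set w' := mmul u' w in Nu' sz; have [u Nu] := sandwich Nu'.
exists (mmul u u') => k; apply: (@normal_suffix _ w').
rewrite -mulmA -/w'; set p := mmul u w'.
(* The product is kept in a form that ends in [w'], where the next copy of
   [w' u w'] is glued. *)
suff [x ->] : exists2 x, mmul w' (wpow p k) = mmul x w' & normal W (mmul x w') by [].
elim: k => [|k [x e Nx]]; first by exists mone; rewrite ?mul1m // mulm1.
have wpowS j : wpow p j.+1 = mmul (wpow p j) p.
  elim: j => [|j IH]; first by rewrite /wpow /= mul1m mulm1.
  by rewrite -[LHS]/(mmul p (wpow p j.+1)) {1}IH mulmA.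
exists (mmul (mmul x w') u); first by rewrite wpowS mulmA e /p mulmA.
rewrite -mulmA -/p; apply: normal_glue => //; last by rewrite /p mulmA.
by move=> v /WN vN; apply: leq_trans vN _; apply: leqW.
Qed.

End Sandwich.

Section MonomialAlgebra.
Variable K : fieldType.
Local Notation free_alg := (free_algebra K n).

(** The elements without normal words in their support form an ideal that
    contains the generators. *)
Lemma ideal_gen_monomials W (f : free_alg) :
  ideal_gen (monomials K W) f -> forall w, w \in msupp f -> ~ normal W w.
Proof.
move=> If; apply: (If [set f | forall w, w \in msupp f -> ~ normal W w]).
split; last first.
  move=> _ [v Wv <-] w; rewrite msuppU1 in_fset1 => /eqP -> /(_ v Wv); apply.
  by exists mone, mone; rewrite mulm1 mul1m.
split; [split|] => [w|f1 f2 If1 If2 w|r f1 If1 w|r f1 If1 w].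
- by rewrite msupp0 in_fset0.
- by move=> /(fsubsetP (msuppB_le _ _)); rewrite in_fsetU => /orP[/If1|/If2].
- by move=> /msuppM_le[u [v [_ /If1 Nv ->]]] /normal_suffix.
- move=> /msuppM_le[u [v [/If1 Nu _ ->]]]; rewrite -[mmul u v]mul1m mulmA.
  by move=> /normal_factor.
Qed.

(** If no [w u w] is normal, then [w f w] vanishes in the monomial algebra for
    every [f], since each of its terms does; semiprimeness gives [w = 0] there,
    so [w] is not normal. *)
Lemma semiprime_sandwich W : semiprime (quot_ring (monomials K W)) ->
  forall w, normal W w -> exists u, normal W (mmul (mmul w u) w).
Proof.
move=> sp w Nw; apply: contrapT => noN; pose x : free_alg := << w >>.
suff /sp : forall r, quot_proj (monomials K W) x * r * quot_proj _ x = 0.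
  move/quot_proj_eq0/ideal_gen_monomials => /(_ w); apply=> //.
  by rewrite msuppU1 in_fset1.
move=> r; have [f ->] := quot_proj_surj r; set pi := quot_proj _.
have -> : pi x * pi f * pi x = pi (x * f * x).
  by rewrite /pi !quot_projM.
apply/quot_proj_eq0.
have [[I0 IB IMl] IMr] := ideal_gen_ideal (monomials K W).
have ID a b : ideal_gen (monomials K W) a -> ideal_gen (monomials K W) b ->
    ideal_gen (monomials K W) (a + b).
  by apply: left_idealD; split.
rewrite [f]monalgE mulr_sumr mulr_suml; elim/big_ind: _ => // u _.
have -> : x * << f@_u *g u >> * x = (f@_u)%:MP * << mmul (mmul w u) w >>.
  by rewrite /x !malgM_def !fgmulUU !mul1r !mulr1 ?mul1m.
apply: (IMl).
have [v Wv [a [b ->]]] : exists2 v, W v & divides v (mmul (mmul w u) w).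
  apply: contrapT => nov; apply: noN; exists u => v Wv dv.
  by apply: nov; exists v.
have -> : << mmul (mmul a v) b >> = << a >> * << v >> * << b >> :> free_alg.
  by rewrite !malgM_def !fgmulUU !mulr1.
by apply: (IMr); apply: (IMl) => J [_]; apply; exists v.
Qed.

End MonomialAlgebra.
End Words.

(** * Leading words in the free algebra *)

Section LeadingWords.
Variables (K : fieldType) (n : nat) (lt : rel (words n)).
Local Notation word := (words n).
Local Notation free_alg := (free_algebra K n).
Local Notation le := (refl_closure lt).
Hypothesis lt_total : total_ordering lt.
Hypothesis lt_mon : monomial_ordering lt.
Implicit Types (u v w : word) (f g : free_alg).

Lemma refl_closure_refl w : le w w. Proof. by rewrite /refl_closure eqxx. Qed.

Lemma refl_closure_trans : transitive le.
Proof.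
have [_ tr _] := lt_total.
move=> v u w /predU1P[->//|uv] /predU1P[<-|vw]; apply/orP; right => //.
exact: tr vw.
Qed.

Lemma refl_closure_total : total le.
Proof.
have [_ _ tot] := lt_total; move=> u v; rewrite /refl_closure.
by case: (tot u v) => [->|->|->]; rewrite ?eqxx ?orbT.
Qed.

Lemma lt_nle u v : lt u v -> ~~ le v u.
Proof.
have [ir tr _] := lt_total => uv; apply/negP => /predU1P[e|vu].
  by rewrite e ir in uv.
by have := tr _ _ _ uv vu; rewrite ir.
Qed.

Lemma refl_closure_mul u u' v v' : le u u' -> le v v' -> le (mmul u v) (mmul u' v').
Proof.
have [_ _ mon _] := lt_mon => uu' vv'; apply: (@refl_closure_trans (mmul u' v)).
  case/predU1P: uu' => [->|uu']; first exact: refl_closure_refl.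
  by have := mon mone _ _ v uu'; rewrite !mul1m /refl_closure => ->; rewrite orbT.
case/predU1P: vv' => [->|vv']; first exact: refl_closure_refl.
by have := mon u' _ _ mone vv'; rewrite !mulm1 /refl_closure => ->; rewrite orbT.
Qed.

(** Strict monotonicity of concatenation, in the form that isolates the leading
    term of a product. *)
Lemma refl_closure_mul_eq u u' v v' : le u u' -> le v v' ->
  mmul u v = mmul u' v' -> u = u' /\ v = v'.
Proof.
have [_ _ mon _] := lt_mon => uu' vv' e; have [ir _ _] := lt_total.
case/predU1P: uu' e => [->|uu'] e.
  split=> //; case/predU1P: vv' e => [->//|vv'] e.
  by have := mon u' _ _ mone vv'; rewrite !mulm1 e ir.
have := mon mone _ _ v uu'; rewrite !mul1m e => /lt_nle /negP[].
exact: refl_closure_mul (refl_closure_refl _) vv'.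
Qed.

Lemma monomial_ordering_min (S : set word) : S !=set0 ->
  exists2 w, S w & forall v, S v -> le w v.
Proof.
have [_ wo _ _] := lt_mon => -[w0 Sw0].
have [|w [[Sw wmin] _]] := wo (fun w => `[< S w >]).
  by exists w0; apply/asboolP.
by exists w => [|v Sv]; [apply/asboolP | apply: wmin; apply/asboolP].
Qed.

Lemma mone_least w : le mone w.
Proof.
have [_ _ _ mon] := lt_mon; rewrite /refl_closure; case: eqP => //= w1.
by apply: (mon w mone w mone); [rewrite !mulm1 | left=> e; apply: w1].
Qed.

(** A relational form of [LM] that excludes its junk value at [0]. *)
Definition is_lead f w := w \in msupp f /\ forall v, v \in msupp f -> le v w.

Lemma LM_lead f : f <> 0 -> is_lead f (LM lt f).
Proof.
move=> f0; rewrite /LM; set s := sort _ _.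
have srt : sorted le s by apply: sort_sorted; exact: refl_closure_total.
have mem_s v : (v \in s) = (v \in msupp f) by rewrite mem_sort.
have : s <> [::].
  move=> s0; apply: f0; apply/eqP; rewrite -msupp_eq0; apply/eqP/fsetP => v.
  by rewrite -mem_s s0.
case/lastP: s srt mem_s => [|s w] // srt mem_s _; rewrite last_rcons; split.
  by rewrite -mem_s mem_rcons inE eqxx.
move: srt; rewrite sorted_pairwise; last exact: refl_closure_trans.
rewrite pairwise_rcons => /andP[/allP smax _] v; rewrite -mem_s mem_rcons inE.
by move=> /predU1P[->|/smax //]; apply: refl_closure_refl.
Qed.

Lemma lead_uniq f v w : is_lead f v -> is_lead f w -> v = w.
Proof.
move=> [vf vmax] [wf wmax]; have /predU1P[//|vw] := wmax _ vf.
by have /negP[] := lt_nle vw; apply: vmax.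
Qed.

Lemma lead_neq0 f w : is_lead f w -> f <> 0.
Proof. by move=> [wf _] f0; rewrite f0 msupp0 in_fset0 in wf. Qed.

Lemma lead_LM f w : is_lead f w -> LM lt f = w.
Proof. by move=> fw; apply: lead_uniq (LM_lead (lead_neq0 fw)) fw. Qed.

Lemma lead_monomial w : is_lead << w >> w.
Proof.
split=> [|v]; rewrite msuppU1 in_fset1 // => /eqP ->.
exact: refl_closure_refl.
Qed.

Lemma lead_mul_coef f g w v : is_lead f w -> is_lead g v ->
  (f * g)@_(mmul w v) = f@_w * g@_v.
Proof.
move=> [wf wmax] [vg vmax]; rewrite mcoeffMl.
rewrite (bigD1_seq w) ?fset_uniq //= (bigD1_seq v) ?fset_uniq //= eqxx mulr1n.
rewrite big_seq_cond big1 ?addr0 => [|v' /andP[v'g /eqP v'v]]; last first.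
  by case: eqP => // /(refl_closure_mul_eq (refl_closure_refl w) (vmax _ v'g))[].
rewrite big_seq_cond big1 ?addr0 // => w' /andP[w'f /eqP w'w].
rewrite big_seq big1 // => v' v'g.
by case: eqP => // /(refl_closure_mul_eq (wmax _ w'f) (vmax _ v'g))[].
Qed.

Lemma lead_mul f g w v : is_lead f w -> is_lead g v -> is_lead (f * g) (mmul w v).
Proof.
move=> lf lg; split.
  rewrite -mcoeff_neq0 lead_mul_coef // mulf_neq0 // mcoeff_neq0.
    by case: lf.
  by case: lg.
move=> u /msuppM_le[w' [v' [w'f v'g ->]]].
by apply: refl_closure_mul; [apply: lf.2 | apply: lg.2].
Qed.

End LeadingWords.

(** * Leading words in the associated graded algebra *)

Lemma gr_class_eq0 (A : pzRingType) (F : filtration A) p u :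
  F p u -> gr_class F p u = 0 <-> fil_lt F p u.
Proof.
move=> Fu; rewrite -(gr_class0 F p) /gr_class eq_gr !val_insubd_fil ?subr0 //.
exact: fil0.
Qed.

Section GradedOrder.
Variables (n : nat) (m : 'I_n -> nat) (lt : rel (words n)).

Lemma graded_lt_total : total_ordering lt -> total_ordering (graded_lt m lt).
Proof.
move=> [ir tr tot]; split=> [u|v u w|u v]; rewrite /graded_lt.
- by rewrite ltnn eqxx ir.
- move=> /orP[uv|/andP[/eqP uv luv]] /orP[vw|/andP[/eqP vw lvw]].
  + by rewrite (ltn_trans uv vw).
  + by rewrite -vw uv.
  + by rewrite uv vw.
  + by rewrite uv vw eqxx (tr _ _ _ luv lvw) orbT.
- case: ltngtP => _ /=; [by constructor 2 | by constructor 3 |].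
  exact: tot.
Qed.

Lemma wdeg_le u v : refl_closure (graded_lt m lt) u v -> (wdeg m u <= wdeg m v)%N.
Proof.
by move=> /predU1P[->//|/orP[/ltnW//|/andP[/eqP-> _]]].
Qed.

Lemma wdeg_gt0 w : (forall i, (0 < m i)%N) -> w <> mone -> (0 < wdeg m w)%N.
Proof.
move=> m_gt0 /size_word_gt0; rewrite /wdeg; case: (fmonom_val w) => // i s _.
by rewrite big_cons addn_gt0 m_gt0.
Qed.

End GradedOrder.

Section LeadingWordsOfSymbols.
Variables (K : fieldType) (n : nat) (m : 'I_n -> nat) (lt : rel (words n)).
Local Notation word := (words n).
Local Notation free_alg := (free_algebra K n).
Local Notation glt := (graded_lt m lt).
Local Notation le := (refl_closure glt).
Hypothesis lt_total : total_ordering lt.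
Hypothesis lt_mon : monomial_ordering glt.
Variable U : set free_alg.
Hypothesis U_groebner : groebner_basis glt U (ideal_gen U).
Local Notation F := (induced_filtration m U).
Local Notation GA := (assoc_graded F).
Local Notation W := (LM_set glt U).
Local Notation deg := (wdeg m).
Implicit Types (u v w : word) (f g : free_alg) (x y : GA).

Let glt_total : total_ordering glt := graded_lt_total m lt_total.

(** The image of [f] in [G(A)_p], of interest when [f] has weights at most [p]. *)
Definition symbol p f : gr F p := gr_class F p (quot_proj U f).

Lemma symbol_fil p f : (forall w, w \in msupp f -> (deg w <= p)%N) ->
  F p (quot_proj U f).
Proof.
by move=> fp; rewrite /= induced_filE; exists f => //; apply/grading_filP.
Qed.

Lemma symbol_low p f : (forall w, w \in msupp f -> (deg w < p)%N) ->
  symbol p f = 0.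
Proof.
move=> fp; have Ff : F p (quot_proj U f) by apply: symbol_fil => w /fp /ltnW.
apply/(gr_class_eq0 Ff) => {Ff}.
case: p fp => [|p] fp; last first.
  by exists p; [exact: ltnSn | apply: symbol_fil => w /fp].
have -> : f = 0; last exact: raddf0.
apply/eqP; rewrite -msupp_eq0; apply/eqP/fsetP => w; rewrite in_fset0.
by apply/negP => /fp.
Qed.

Lemma symbol_lead_deg f w p :
  is_lead glt f w -> (deg w <= p)%N -> F p (quot_proj U f).
Proof.
by move=> [_ wmax] wp; apply: symbol_fil => v /wmax /wdeg_le /leq_trans; apply.
Qed.

(** Here the Groebner basis property enters: the leading word of an element of
    the ideal lies in the monomial ideal of [LM(G)]. *)
Lemma lead_ideal f w : ideal_gen U f -> is_lead glt f w -> ~ normal W w.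
Proof.
move=> If fw; apply: (@ideal_gen_monomials _ K W << w >>); last first.
  by rewrite msuppU1 in_fset1.
rewrite -U_groebner.2 => J [_]; apply; exists w => //.
exists f; last exact: lead_LM fw.
by split=> //; exact: lead_neq0 fw.
Qed.

(** If the symbol were zero, [f] would be congruent modulo [I] to some [h] of
    lower weight, and [f - h] in [I] would still have the leading word [w]. *)
Lemma symbol_normal_neq0 f w : is_lead glt f w -> normal W w ->
  symbol (deg w) f <> 0.
Proof.
move=> fw Nw /(gr_class_eq0 (symbol_lead_deg fw (leqnn _))) low.
have [h hlow eh] : exists2 h, forall v, v \in msupp h -> (deg v < deg w)%N &
    quot_proj U f = quot_proj U h.
  move: low; case: (deg w) => [->|p [q /= qp]].
    by exists 0; [move=> v; rewrite msupp0 in_fset0 | rewrite raddf0].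
  rewrite induced_filE => -[h /grading_filP hq <-]; exists h => // v /hq vq.
  exact: leq_ltn_trans qp.
apply: (@lead_ideal (f - h) w) => //; first exact/eq_quot_proj.
have [wf wmax] := fw; split.
  rewrite -mcoeff_neq0 mcoeffB (mcoeff_outdom (g := h)) ?subr0 ?mcoeff_neq0 //.
  by apply/negP => /hlow; rewrite ltnn.
move=> v /(fsubsetP (msuppB_le _ _)); rewrite in_fsetU => /orP[/wmax//|/hlow vw].
by rewrite /refl_closure /graded_lt vw orbT.
Qed.

Lemma symbol_ex_lead p f : (forall w, w \in msupp f -> (deg w <= p)%N) ->
  symbol p f <> 0 -> exists2 w, is_lead glt f w & deg w = p.
Proof.
move=> fp f0; have fneq0 : f <> 0.
  by move=> e; apply: f0; apply: symbol_low => w; rewrite e msupp0 in_fset0.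
have lf := LM_lead glt_total fneq0; exists (LM glt f) => //.
have := fp _ lf.1; rewrite leq_eqVlt => /predU1P[//|ltp]; case: f0.
apply: symbol_low => v /lf.2 /wdeg_le vLM; exact: leq_ltn_trans ltp.
Qed.

(** One step of division by the basis: subtracting a multiple of [a g b], whose
    leading word is [w], cancels [w].  The rest cannot drop to lower weight
    since the symbol is unchanged and nonzero. *)
Lemma symbol_reduce f w : is_lead glt f w -> ~ normal W w ->
  symbol (deg w) f <> 0 -> exists f' w', [/\ is_lead glt f' w', glt w' w,
    deg w' = deg w & symbol (deg w) f' = symbol (deg w) f].
Proof.
move=> fw Nw f0.
have [_ [g [Ug g0] <-] [a [b e]]] : exists2 v, W v & divides v w.
  by apply: contrapT => nov; apply: Nw => v Wv dv; apply: nov; exists v.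
have lg := LM_lead glt_total g0.
pose h := << a >> * g * << b >> : free_alg.
have hw : is_lead glt h w.
  by rewrite e; do 2?[apply: lead_mul] => //; apply: lead_monomial.
have Ih : ideal_gen U h.
  have [[_ _ IMl] IMr] := ideal_gen_ideal U.
  by apply: (IMr); apply: (IMl) => J [_]; apply; exact: Ug.
pose f' := f - (f@_w / h@_w)%:MP * h.
have f'w : f'@_w = 0.
  by rewrite mcoeffB mcoeffCM divfK ?subrr // mcoeff_neq0; case: hw.
have f'le v : v \in msupp f' -> le v w.
  move=> /(fsubsetP (msuppB_le _ _)); rewrite in_fsetU => /orP[/fw.2//|].
  by rewrite mul_malgC => /(fsubsetP (msuppZ_le _ _)) /hw.2.
have ef' : symbol (deg w) f' = symbol (deg w) f.
  congr (gr_class F); apply/eq_quot_proj; rewrite /f' addrAC subrr sub0r -mulNr.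
  by have [[_ _ IMl] _] := ideal_gen_ideal U; apply: IMl.
have [||w' f'w' dw'] := @symbol_ex_lead (deg w) f'; rewrite ?ef' //.
  by move=> v /f'le /wdeg_le.
exists f', w'; split=> //; have /predU1P[ew|//] := f'le _ f'w'.1.
by have := f'w'.1; rewrite ew -mcoeff_neq0 f'w eqxx.
Qed.

(** Among all the words that lead a representative of [z], the least one is
    normal, because [symbol_reduce] would make it smaller. *)
Lemma ex_normal_lead p (z : gr F p) : z <> 0 ->
  exists f w, [/\ is_lead glt f w, normal W w, deg w = p & z = symbol p f].
Proof.
move=> z0.
pose S := [set w | exists f, [/\ is_lead glt f w, deg w = p & z = symbol p f]].
have S0 : S !=set0.
  have /fil_predP := filtP (repr z); rewrite /= induced_filE.
  move=> [f /grading_filP fp ef].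
  have zf : z = symbol p f by rewrite /symbol ef -gr_classE reprK.
  have [|w fw dw] := symbol_ex_lead fp; first by rewrite -zf.
  by exists w, f.
have [w [f [fw dw zf]] wmin] := monomial_ordering_min lt_mon S0.
exists f, w; split=> //; apply: contrapT => Nw.
have [|f' [w' [f'w' lw dw' ef']]] := symbol_reduce fw Nw; first by rewrite dw -zf.
have /negP[] := lt_nle glt_total lw; apply: wmin; exists f'.
by rewrite dw' zf -dw ef'.
Qed.

(** [w] leads the top component of [x].  The word may fail to be normal, and then
    [x] may be zero: a leading word is attached to a chosen representative,
    which makes [leads] compatible with all products. *)
Definition leads x w :=
  gdeg_le (deg w) x /\ exists2 f, is_lead glt f w & x (deg w) = symbol (deg w) f.

Lemma leads_mul x y w v : leads x w -> leads y v -> leads (x * y) (mmul w v).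
Proof.
move=> [tx [f fw xf]] [ty [g gv yg]]; split; first by rewrite wdegM; apply: gdeg_leM.
exists (f * g); first exact: lead_mul.
rewrite wdegM gcoefM_top // xf yg gr_mul_class; last 2 first.
- exact: symbol_lead_deg fw _.
- exact: symbol_lead_deg gv _.
by rewrite /symbol quot_projM.
Qed.

Lemma leads_neq0 x w : leads x w -> normal W w -> x <> 0.
Proof.
move=> [_ [f fw xf]] Nw x0; apply: (symbol_normal_neq0 fw Nw).
by rewrite -xf x0.
Qed.

Lemma leads_ex p x : gdeg_le p x -> x p <> 0 ->
  exists w, [/\ leads x w, normal W w & deg w = p].
Proof.
move=> tx /ex_normal_lead[f [w [fw Nw dw xf]]]; exists w; split=> //.
by split; rewrite dw //; exists f.
Qed.

Lemma leads_gcomp x w : leads x w -> leads (gcomp (deg w) x) w.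
Proof.
move=> [_ [f fw xf]]; split; first exact: gcomp_le.
by exists f; rewrite ?gcompE.
Qed.

(** [hsymbol p f] below is the symbol of [f] as a homogeneous element of degree
    [p] of [G(A)]. *)
Definition hsymbol_coef p f q : gr F q := if q == p then symbol q f else 0.

Lemma hsymbol_fin p f :
  exists N, forall q, (N <= q)%N -> hsymbol_coef p f q = 0.
Proof. by exists p.+1 => q pq; rewrite /hsymbol_coef gtn_eqF. Qed.

Definition hsymbol p f : GA := AssocGraded (hsymbol_fin p f).

Lemma hsymbol_le p f : gdeg_le p (hsymbol p f).
Proof. by move=> q pq; rewrite /= /hsymbol_coef gtn_eqF. Qed.

Lemma hsymbol_ge p f : gdeg_ge p (hsymbol p f).
Proof. by move=> q pq; rewrite /= /hsymbol_coef ltn_eqF. Qed.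

Lemma hsymbolE p f : hsymbol p f p = symbol p f.
Proof. by rewrite /= /hsymbol_coef eqxx. Qed.

Lemma leads_monomial u : leads (hsymbol (deg u) << u >>) u.
Proof.
split; first exact: hsymbol_le.
by exists << u >>; rewrite ?hsymbolE //; apply: lead_monomial.
Qed.

Lemma one_coef0 : (1 : GA) 0%N = symbol 0 1.
Proof. exact: gr_classE. Qed.

Lemma leads_one : leads 1 mone.
Proof.
rewrite /leads wdeg1; split; first exact: gdeg_le1.
exists (<< mone >>); first exact: lead_monomial.
exact: one_coef0.
Qed.

Lemma leads_exp x w k : leads x w -> leads (x ^+ k) (wpow w k).
Proof.
move=> xw; elim: k => [|k IH]; first exact: leads_one.
by rewrite exprS; apply: leads_mul.
Qed.

(** The empty word is the least one, so such an [x] comes from a nonzero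
    constant. *)
Lemma leads_mone_unit x : leads x mone -> exists r, r * x = 1.
Proof.
rewrite /leads wdeg1 => -[tx [f [fw fmax] xf]].
pose c := f@_mone; have c0 : c != 0 by rewrite mcoeff_neq0.
have fc : f = c%:MP.
  apply/malgP => v; rewrite mcoeffC; case: (v =P mone) => [->|v1].
    by rewrite mulr1n.
  rewrite mulr0n; apply: mcoeff_outdom; apply/negP => /fmax /predU1P[//|lv].
  by have /negP[] := lt_nle glt_total lv; apply: mone_least.
exists (hsymbol 0 (c^-1)%:MP); apply: assoc_gradedP => q.
have [q0|q0] := posnP q; last first.
  by rewrite (gdeg_leM (@hsymbol_le 0 _) tx) // gdeg_le1.
rewrite {}q0 -[0%N]addn0 gcoefM_top //; last exact: hsymbol_le.
rewrite hsymbolE xf fc gr_mul_class; try by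
  apply: symbol_fil => v /(fsubsetP (msuppC_le _)); rewrite in_fset1;
  move=> /eqP ->; rewrite wdeg1.
have e1 : (1 : free_alg) = c^-1%:MP * c%:MP by rewrite -mpolyCM mulVf.
by rewrite one_coef0 /symbol e1 quot_projM.
Qed.

End LeadingWordsOfSymbols.

(** * Semiprimitivity of the associated graded algebra *)

Theorem theorem3p3 (K : fieldType) (n : nat)
    (m : 'I_n -> nat) (m_gt0 : forall i, (0 < m i)%N)
    (lt : rel (words n)) (lt_total : total_ordering lt)
    (lt_gr_monomial : monomial_ordering (graded_lt m lt))
    (G : seq (free_algebra K n)) (I : set (free_algebra K n))
    (I_gen : I = ideal_gen [set` G]) (I_proper : I <> setT)
    (G_groebner : groebner_basis (graded_lt m lt) [set` G] I)
    (LMG_letters : LM_set (graded_lt m lt) [set` G] `&` letters = set0)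
    (LMG_reduced : reduced (LM_set (graded_lt m lt) [set` G])) :
  semiprime (quot_ring (monomials K (LM_set (graded_lt m lt) [set` G]))) ->
  semiprimitive (assoc_graded (induced_filtration m [set` G])).
Proof.
set W := LM_set _ _; set F := induced_filtration _ _ => spW.
set J := @jacobson_radical (assoc_graded F).
have LJ : left_ideal J := jacobson_radical_left_ideal _.
apply/seteqP; split=> [x Jx|_ ->]; last by case: LJ.
apply: contrapT => x_neq0; rewrite I_gen in G_groebner.
have Jquasi z : J z -> left_quasi_regular z by rewrite /J jacobson_radicalE.
have [t [y [Jy ty yt ycomm]]] :=
  ex_top_commuting LJ (@jacobson_radicalMr _) Jx x_neq0.
have [w [yw Nw dw]] := leads_ex lt_total lt_gr_monomial ty yt.
have [w1|w1] := pselect (w = mone).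
  rewrite w1 in yw Nw.
  have [r ry] := leads_mone_unit lt_total lt_gr_monomial yw.
  have [z] := Jquasi _ Jy r; rewrite ry subrr mulr0 => /esym.
  exact: (leads_neq0 lt_total G_groebner (leads_one m lt [set` G]) Nw).
(* A bound for the lengths of the words in [LM(G)]. *)
pose N := (\max_(g <- G) size (LM (graded_lt m lt) g))%N.
have [] := normal_powers (N := N) (semiprime_sandwich spW) _ Nw w1.
  by move=> _ [g [Gg _] <-]; apply: leq_bigmax_seq.
move=> u Nuw.
pose s : assoc_graded F := hsymbol m [set` G] (wdeg m u) << u >>.
have su : leads lt s u := leads_monomial _ _ _ u.
have suy := leads_mul lt_total lt_gr_monomial su yw.
pose d := wdeg m (mmul u w).
have d_gt0 : (0 < d)%N.
  by rewrite /d wdegM addn_gt0 (wdeg_gt0 m_gt0 w1) orbT.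
have [z zs] := Jquasi _ (left_idealM s LJ Jy) 1; rewrite mul1r in zs.
apply: (no_left_inverse d_gt0 suy.1 _ _ zs).
  by rewrite /d wdegM dw; apply: ycomm; [exact: hsymbol_le|exact: hsymbol_ge].
move=> k.
have lead_k := leads_exp lt_total lt_gr_monomial k (leads_gcomp suy).
exact: (leads_neq0 lt_total G_groebner lead_k (Nuw k)).
Qed.
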